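(* Let $p$ be a prime and let $P$ be a $p$-group of order $p^n$, with $n>1$, and exponent $p$. Then there exists a finite solvable $p'$-group $N$ of Fitting height $n$ such that $P$ acts on $N$, $C_N(P)=1$, and the semidirect product $G=N\rtimes P$ has a redundant Sylow $p$-subgroup.
   Context: For a finite group $G$ and a prime $p$, $G_p$ denotes the set of $p$-elements of $G$ and $\mathrm{Syl}_p(G)$ the set of Sylow $p$-subgroups of $G$. $G$ is said to have a redundant Sylow $p$-subgroup if $G_p$ is contained in the union of the members of some proper subset of $\mathrm{Syl}_p(G)$. The Fitting height of a solvable group is the length of its Fitting series $1=F_0\le F_1\le\cdots$, where $F_i/F_{i-1}$ is the Fitting subgroup of $G/F_{i-1}$. *)

(* Defs.v *)
From mathcomp Require Import all_boot all_fingroup all_solvable.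
Set Implicit Arguments. Unset Strict Implicit. Unset Printing Implicit Defensive.
Import GroupScope.
Local Open Scope group_scope.

Fixpoint fitting_series (gT : finGroupType) (G : {set gT}) (i : nat) : {set gT} :=
  match i with
  | 0 => 1
  | i'.+1 => coset (fitting_series G i') @*^-1 'F(G / fitting_series G i')
  end.

Definition fitting_height_eq (gT : finGroupType) (G : {set gT}) (n : nat) : Prop :=
  fitting_series G n = G /\ (forall m, (m < n)%N -> fitting_series G m != G).

Definition p_elements (gT : finGroupType) (p : nat) (G : {set gT}) : {set gT} :=
  [set x in G | p.-elt x].

Definition redundant_Sylow (gT : finGroupType) (p : nat) (G : {set gT}) : Prop :=
  exists T : {set {group gT}},
    T \proper 'Syl_p(G) /\ p_elements p G \subset \bigcup_(S in T) S.

(* Main.v *)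
Require Import Defs.
From mathcomp Require Import all_boot all_fingroup all_solvable.
From mathcomp Require Import zmodp.
Import GroupScope.
Local Open Scope group_scope.

(** Induction on [n].  Let [Z] be a central subgroup of order [p] of [P], and
    let [P / Z] act on [N1] as given by induction.  Let [W] be the regular
    module, over a large prime field [F_q], of a group containing the semidirect
    product of [N1] by [P], and put [V = [W, Z]] and [N = V ><| N1].  Since the
    action is coprime, [Z] has no fixed points on [V], hence neither has [P] on
    [N]; as [N1] acts faithfully on [V], ['F(N) = V] and the Fitting height
    grows by one.  An element [u] of [P] has fixed points on [N]: if [u] is in
    [Z] it centralises [N1], and otherwise [<[u]> :&: Z = 1] because [P] has
    exponent [p], so that commuting [z] in [Z] with the indicator function of
    [<[u]>] gives a nontrivial element of [V] fixed by [u].  Finally, if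
    ['C_N(P) = 1] and [1 != c \in 'C_N[u]], then [P :^ c] is a Sylow subgroup
    other than [P] that contains [u], so that [P] is redundant. *)

(** * Fitting series and Fitting height *)

(** Iterating [%%] with the Fitting functor produces the series, so the generic functor results
    supply its group structure, normality and transport along injective morphisms. *)
Lemma fitting_series_pgFun (i : nat) :
  {F : GFunctor.pmap |
    forall (gT : finGroupType) (A : {set gT}), F gT A = fitting_series A i}.
Proof.
elim: i => [|i [F defF]]; first by exists [pgFun of trivGfun].
exists [pgFun of (@Fitting %% F)%gF] => gT A /=.
by rewrite /GFunctor.modulo /= defF.
Qed.

Section FittingSeries.

Context {gT : finGroupType}.
Implicit Types G H : {group gT}.

Lemma fitting_series_group_set G i : group_set (fitting_series G i).
Proof. by have [F <-] := fitting_series_pgFun i; apply: gFgroupset. Qed.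
Canonical fitting_series_group G i := Group (fitting_series_group_set G i).

Lemma fitting_series_normal G i : fitting_series G i <| G.
Proof. by have [F <-] := fitting_series_pgFun i; apply: gFnormal. Qed.

Lemma fitting_series_sub G i : fitting_series G i \subset G.
Proof. exact: normal_sub (fitting_series_normal G i). Qed.

Lemma injm_fitting_series (rT : finGroupType) G (D : {group gT})
    (f : {morphism D >-> rT}) i :
  'injm f -> G \subset D ->
  f @* fitting_series G i = fitting_series (f @* G) i.
Proof.
by have [F defF] := fitting_series_pgFun i; rewrite -!defF; apply: injmF.
Qed.

Lemma fitting_series1 G : fitting_series G 1 = 'F(G).
Proof.
have f1: 'injm (coset (1 : {set gT})) by rewrite ker_coset.
have F1: 'F(G) / 1 = 'F(G / 1) by apply: injmF; rewrite ?norms1.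
rewrite [LHS]/= -F1.
exact: quotientGK (normal1 _).
Qed.

Lemma fitting_series_succ_sub G i :
  fitting_series G i \subset fitting_series G i.+1.
Proof.
by rewrite /= -{1}(ker_coset (fitting_series_group G i)) morphpreS ?sub1G.
Qed.

Lemma Fitting_sub_series G i : 'F(G) \subset fitting_series G i.+1.
Proof.
elim: i => [|i IHi]; first by rewrite fitting_series1.
exact: subset_trans IHi (fitting_series_succ_sub G i.+1).
Qed.

(** By induction: the third isomorphism between [(G / 'F(G)) / (A / 'F(G))] and [G / A] matches
    Fitting subgroups, so both sides have the same image modulo [A / 'F(G)]. *)
Lemma fitting_series_quotient G i :
  fitting_series G i.+1 / 'F(G) = fitting_series (G / 'F(G)) i.
Proof.
elim: i => [|i IHi]; first by rewrite fitting_series1 trivg_quotient.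
set A := fitting_series_group G i.+1; set X := fitting_series_group G i.+2.
have sXG : X \subset G := fitting_series_sub G i.+2.
have sAX : A \subset X := fitting_series_succ_sub G i.+1.
have sFA : 'F(G) \subset A := Fitting_sub_series G i.
have nAG : A <| G := fitting_series_normal G i.+1.
have defX : X / A = 'F(G / A).
  exact: cosetpreK.
have [f injf im_f] := third_isom sFA (Fitting_normal G) nAG.
have nAX : A / 'F(G) <| X / 'F(G).
  by rewrite quotient_normal // (normalS sAX sXG).
have defXF : X / 'F(G) / (A / 'F(G)) = 'F(G / 'F(G) / (A / 'F(G))).
  apply: (injm_morphim_inj injf); rewrite ?quotientS ?Fitting_sub //.
  by rewrite injmF // !im_f // defX.
rewrite [RHS]/= -IHi -defXF; apply/esym.
exact: quotientGK nAX.
Qed.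

End FittingSeries.

Lemma isog_fitting_height (gT rT : finGroupType) (G : {group gT})
    (H : {group rT}) n :
  G \isog H -> fitting_height_eq G n -> fitting_height_eq H n.
Proof.
case/isogP=> f injf <- [Gn Gm]; split=> [|m /Gm ltGm].
  by rewrite -injm_fitting_series ?Gn.
rewrite -injm_fitting_series //; apply: contraNneq ltGm => eq_f.
by rewrite (injm_morphim_inj injf _ _ eq_f) ?fitting_series_sub.
Qed.

Lemma fitting_height_succ (gT : finGroupType) (G : {group gT}) n :
    G :!=: 1 -> fitting_height_eq (G / 'F(G)) n ->
  fitting_height_eq G n.+1.
Proof.
move=> ntG [Gn Gm].
have eqG m: (fitting_series G m.+1 == G) =
            (fitting_series (G / 'F(G)) m == G / 'F(G)).
  rewrite -fitting_series_quotient; apply/eqP/eqP=> [-> // | eqF].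
  have nF (H : {group gT}) : 'F(G) \subset H -> H \subset G -> 'F(G) <| H.
    by move=> sFH sHG; apply: normalS sFH sHG (Fitting_normal G).
  apply: (@quotient_inj _ 'F(G) (fitting_series_group G m.+1) G) => //.
    exact: nF (Fitting_sub_series G m) (fitting_series_sub G m.+1).
  exact: Fitting_normal.
split=> [|[|m] lt_mn]; first by apply/eqP; rewrite eqG Gn.
  by rewrite eq_sym.
by rewrite eqG Gm.
Qed.

(** * Translation modules over ['Z_q] and their semidirect products *)

Section RegularWreath.

Context (aT : finGroupType) (D : {group aT}) (q : nat).

Local Notation base := {dffun forall _ : aT, 'Z_q}.

(** Left multiplication of the argument gives a right action. Since [k] runs over all of [aT],
    [base] is a direct sum of copies of the regular module of [D], one for each coset of [D]. *)
Definition translate (v : base) (a : aT) : base := [ffun k => v (a * k)].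

Lemma translate_is_action : is_action D translate.
Proof.
split=> [a v w /ffunP eq_vw | v a b _ _].
  by apply/ffunP=> k; have:= eq_vw (a^-1 * k); rewrite !ffunE mulKVg.
by apply/ffunP=> k; rewrite !ffunE mulgA.
Qed.
Canonical translate_action := Action translate_is_action.

Lemma translate_is_groupAction : is_groupAction [set: base] translate_action.
Proof.
move=> a Da /=; rewrite inE; apply/andP; split.
  by apply/subsetP=> v _; rewrite inE.
by apply/morphicP=> v w _ _; rewrite !actpermE; apply/ffunP=> k; rewrite !ffunE.
Qed.
Canonical translate_groupAction := GroupAction translate_is_groupAction.

Definition indicator (A : {set aT}) : base :=
  [ffun k => if k \in A then Zp1 else 1].

Local Notation f := (sdpair1 translate_groupAction).
Local Notation g := (sdpair2 translate_groupAction).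

Lemma regular_wreath_conj v a : a \in D -> f v ^ g a = f (translate v a).
Proof. by move=> Da; rewrite -sdpair_act ?inE. Qed.

Lemma regular_wreath_inj : injective f.
Proof. by move=> v w; apply: (injmP (injm_sdpair1 _)); rewrite inE. Qed.

(** Compare values at [1]; [Zp1] differs from the identity since ['Z_q] has at least two elements
    for every [q]. *)
Lemma regular_wreath_indicator (H : {group aT}) a :
  a \in D -> (f (indicator H) ^ g a == f (indicator H)) = (a \in H).
Proof.
move=> Da; rewrite regular_wreath_conj // (inj_eq regular_wreath_inj).
apply/eqP/idP=> [/ffunP/(_ 1) | Ha]; last first.
  by apply/ffunP=> k; rewrite !ffunE groupMl.
by rewrite !ffunE mulg1 group1; case: ifP.
Qed.

(** At [1] the commutator takes the value [Zp1^-1], because [z != 1]. Its conjugate takes there the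
    value of the commutator at [m], which is trivial because neither [m] nor [z * m] is [1]. *)
Lemma regular_wreath_commg_moved z m :
    z \in D -> m \in D -> z != 1 -> m != 1 -> z * m != 1 ->
  [~ f (indicator 1), g z] ^ g m != [~ f (indicator 1), g z].
Proof.
move=> Dz Dm ntz ntm ntzm; rewrite commgEl regular_wreath_conj //.
rewrite -morphV ?inE // -morphM ?inE // regular_wreath_conj //.
rewrite (inj_eq regular_wreath_inj); apply/eqP=> /ffunP/(_ 1)/eqP.
rewrite !ffunE !inE !(mulg1 m, mulg1 z, mulg1 (z * m), mulgA) eqxx.
rewrite (negPf ntz) (negPf ntm) (negPf ntzm).
by rewrite mulg1 invg1 mulg1 eq_sym invg_eq1.
Qed.

Lemma regular_wreath_abelian : abelian (f @* [set: base]).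
Proof.
apply: morphim_abelian; apply/centsP=> v _ w _.
by apply/ffunP=> k; rewrite !ffunE Zp_mulgC.
Qed.

Lemma regular_wreath_pgroup : prime q -> q.-group (f @* [set: base]).
Proof.
move=> q_pr; rewrite morphim_pgroup // /pgroup cardsT.
have -> : #|{: base}| = (#|'Z_q| ^ #|aT|)%N by apply: card_ffun.
by rewrite card_ord Zp_cast ?prime_gt1 // pnatX pnat_id ?orbT.
Qed.

End RegularWreath.

(** * Criteria for redundancy and for the Fitting subgroup *)

Section Redundancy.

Context {gT : finGroupType}.
Implicit Types N Q G V H : {group gT}.

Lemma redundant_Sylow_sdprod (p : nat) G N Q :
    N ><| Q = G -> p.-Sylow(G) Q -> 'C_N(Q) = 1 ->
    (forall y, y \in Q -> 'C_N[y] != 1) ->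
  redundant_Sylow p G.
Proof.
case/sdprodP=> _ defG nNQ tiNQ sylQ cNQ1 cNu.
have sNG : N \subset G by rewrite -defG mulG_subl.
exists ('Syl_p(G) :\ Q); split.
  by apply: properD1; rewrite inE.
apply/subsetP=> y; rewrite inE => /andP[Gy py].
have [S sylS sy] : {S : {group gT} | p.-Sylow(G) S & <[y]> \subset S}.
  by apply: Sylow_superset; rewrite ?cycle_subG.
have Sy : y \in S by rewrite -cycle_subG.
have [eqSQ | neqSQ] := eqVneq S Q; last first.
  by apply/bigcupP; exists S; rewrite // !inE neqSQ.
rewrite eqSQ in Sy.
have /trivgPn[c /setIP[Nc cyc] ntc] := cNu y Sy.
apply/bigcupP; exists (Q :^ c)%G.
  rewrite !inE pHallJ ?(subsetP sNG) // sylQ andbT.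
  (* If [Q :^ c = Q], the commutators of [c] with [Q] lie in [N :&: Q = 1], so that [c] is in
     ['C_N(Q) = 1]. *)
  apply: contraNneq ntc => eqQ; rewrite -in_set1 -[[set 1]]cNQ1 inE Nc /=.
  have nQc : c \in 'N(Q) by rewrite inE -{2}eqQ.
  apply/centP=> x Qx; apply/esym/commgP.
  rewrite -in_set1 -[[set 1]]tiNQ inE commgEr groupMr ?groupV //.
  rewrite memJ_norm ?(subsetP nNQ) ?groupV ?groupV // Nc /=.
  by rewrite -commgEr commgEl groupMl ?groupV // memJ_norm.
by rewrite mem_conjg conjgE invgK mulgA (cent1P cyc) mulgK.
Qed.

(** The normal subgroups [V] and ['O_q^'(G)] have coprime orders, hence commute; as [V] contains its
    centraliser, ['O_q^'(G)] is trivial and ['F(G) = 'O_q(G) = V]. *)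
Lemma Fitting_eq_abelian_Hall (q : nat) G V :
  q.-Hall(G) V -> V <| G -> abelian V -> 'C_G(V) \subset V -> 'F(G) = V.
Proof.
move=> hallV nVG abV sCV; rewrite -(normal_Hall_pcore hallV nVG).
apply: Fitting_eq_pcore; set K := 'O_q^'(G).
have coVK : coprime #|V| #|K|.
  exact: pnat_coprime (pHall_pgroup hallV) (pcore_pgroup _ _).
have sKV : K \subset V.
  apply: subset_trans sCV; rewrite subsetI pcore_sub; apply/commG1P/trivgP.
  rewrite -(coprime_TIg coVK) setIC commg_subI // subsetI.
    by rewrite subxx (subset_trans (pcore_sub _ _)) ?normal_norm.
  by rewrite subxx (subset_trans (normal_sub nVG)) ?gFnorm.
by rewrite -(setIidPr sKV) coprime_TIg.
Qed.

End Redundancy.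

(** * The inductive construction *)

(** [N] and the copy [f @* P] of [P] share one ambient group. The last clause needs [1 < n]: if [P]
    has order [p], a generator fixes only what [P] fixes, namely [1]. *)
Definition fpf_tower (p n : nat) {gT0 : finGroupType} (P : {group gT0}) :=
  exists (gT : finGroupType) (N : {group gT}) (f : {morphism P >-> gT}),
  [/\ 'injm f, f @* P \subset 'N(N), p^'.-group N, solvable N
    & 'C_N(f @* P) = 1] /\
  fitting_height_eq N n /\
  (1 < n -> forall u, u \in P -> 'C_N[f u] != 1).

Lemma fpf_tower_step (p n : nat) (gT0 : finGroupType) (P Z : {group gT0}) :
    prime p -> exponent P %| p -> Z \subset 'Z(P) -> #|Z| = p ->
  fpf_tower p n (P / Z)%G -> fpf_tower p n.+1 P.
Proof.
move=> p_pr expP sZZ oZ [gT1 [N1 [f1 [[injf1 nN1 p'N1 solN1 cN1] [htN1 _]]]]].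
have [sZP cPZ] := subsetIP sZZ; rewrite centsC in cPZ.
have nZP : P \subset 'N(Z) by apply: cents_norm.
have f1Z z : z \in Z -> f1 (coset Z z) = 1 by move/coset_id->; apply: morph1.
(* The semidirect product of [N1] by [P] embeds in this direct product: [m] in [N1] goes to [(m, 1)]
   and [x] in [P] to [(f1 (coset Z x), x)]. *)
pose D := [group of setX [set: gT1] P].
have [q ltDq q_pr] := prime_above #|D|.
have coqD : coprime q #|D|.
  by rewrite prime_coprime // gtnNdvd // cardG_gt0.
have ltPq : #|P| < q.
  by apply: leq_ltn_trans ltDq; rewrite cardsX leq_pmull // cardG_gt0.
have neq_qp : q != p.
  rewrite neq_ltn; apply/orP; right; apply: leq_ltn_trans ltPq.
  by rewrite -oZ subset_leq_card.
pose T := sdprod_by (translate_groupAction _ D q).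
pose e := sdpair1 (translate_groupAction _ D q).
pose g := sdpair2 (translate_groupAction _ D q).
have injg : 'injm g := injm_sdpair2 _.
have gM : {in D &, {morph g : x y / x * y}} := morphM _.
have gJ : {in D &, forall x y, g x ^ g y = g (x ^ y)}.
  by move=> x y Dx Dy; rewrite [RHS]morphJ.
have pairJ (m a : gT1) (x : gT0) : (m, 1) ^ (a, x) = (m ^ a, 1).
  by rewrite -[1 in RHS](conj1g x).
have DfP x y : y \in P -> (x, y) \in D by move=> Py; rewrite !inE.
have gI x y x' y' :
    y \in P -> y' \in P -> g (x, y) = g (x', y') -> x = x' /\ y = y'.
  by move=> Py Py' /(injmP injg _ _ (DfP x y Py) (DfP x' y' Py'))[].
have fM : {in P &, {morph (fun x => g (f1 (coset Z x), x)) : x y / x * y}}.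
  move=> x y Px Py; rewrite -gM ?DfP //; congr (g (_, _)).
  by rewrite !morphM ?mem_quotient ?(subsetP nZP).
have hM : {in N1 &, {morph (fun x => g (x, 1)) : x y / x * y}}.
  by move=> x y _ _; rewrite -gM ?DfP //; congr (g (_, _)); rewrite mulg1.
pose f := Morphism fM; pose h := Morphism hM.
have fE x : f x = g (f1 (coset Z x), x) by [].
have hE x : h x = g (x, 1) by [].
have injf : 'injm f.
  apply/injmP=> x y Px Py; by rewrite !fE => /gI[].
have injh : 'injm h.
  by apply/injmP=> x y _ _; rewrite !hE => /gI[].
pose W := (e @* [set: {dffun forall _ : gT1 * gT0, 'Z_q}])%G.
pose Q := (f @* P)%G; pose M := (h @* N1)%G; pose Y := (f @* Z)%G.
pose K := (g @* D)%G.
have abW : abelian W := regular_wreath_abelian _ _ _.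
have qW : q.-group W by apply: regular_wreath_pgroup.
have nWK : K \subset 'N(W) := im_sdpair_norm _.
have tiWK : W :&: K = 1 := im_sdpair_TI _.
have sQK : Q \subset K.
  apply/subsetP=> _ /morphimP[x Px _ ->]; by rewrite fE mem_morphim ?DfP.
have sMK : M \subset K.
  by apply/subsetP=> _ /morphimP[x Nx _ ->]; rewrite hE mem_morphim ?DfP.
have sYQ : Y \subset Q by apply: morphimS.
have cYQ : Q \subset 'C(Y) by apply: morphim_cents.
have cYM : M \subset 'C(Y).
  apply/centsP=> _ /morphimP[m Nm _ ->] _ /morphimP[z Pz Zz ->].
  rewrite hE fE f1Z // /commute -!gM ?DfP //; congr (g (_, _)).
    by rewrite mulg1 mul1g.
  by rewrite mulg1 mul1g.
have nMQ : Q \subset 'N(M).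
  apply/subsetP=> _ /morphimP[x Px _ ->]; rewrite inE.
  apply/subsetP=> _ /imsetP[_ /morphimP[m Nm _ ->] ->].
  rewrite fE hE gJ ?DfP //; apply/morphimP.
  have Nmx : m ^ f1 (coset Z x) \in N1.
    by rewrite memJ_norm // (subsetP nN1) // mem_morphim ?mem_quotient.
  by exists (m ^ f1 (coset Z x)); rewrite // hE pairJ.
(* [Q] and [M] centralise [Y] and normalise [W], so they normalise [V]. *)
pose V := [~: W, Y]%G.
have nWQ := subset_trans sQK nWK; have nWM := subset_trans sMK nWK.
have nWY := subset_trans sYQ nWQ.
have sVW : V \subset W by rewrite commg_subl.
have abV : abelian V := abelianS sVW abW.
have qV : q.-group V := pgroupS sVW qW.
have nVQ : Q \subset 'N(V) by rewrite normsR // cents_norm.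
have nVM : M \subset 'N(V) by rewrite normsR // cents_norm.
have q'K : q^'.-group K.
  by rewrite morphim_pgroup // /pgroup p'natE // -prime_coprime.
have coWY : coprime #|W| #|Y|.
  exact: pnat_coprime qW (pgroupS (subset_trans sYQ sQK) q'K).
have cVY : 'C_V(Y) = 1 by apply: coprime_abel_cent_TI.
have tiVM : V :&: M = 1.
  by apply/trivgP; rewrite -tiWK setISS.
have defN : V ><| M = V <*> M by rewrite sdprodEY.
have eqVM : V <*> M = V * M by rewrite norm_joinEr.
have memN y : y \in V <*> M -> exists v m, [/\ v \in V, m \in M & y = v * m].
  by rewrite eqVM => /mulsgP[v m Vv Mm ->]; exists v, m.
have cNQ : 'C_(V <*> M)(Q) = 1.
  apply/trivgP/subsetP=> y /setIP[/memN[v [m [Vv Mm ->]]] cvm].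
  (* [Q] normalises both factors and [V :&: M = 1], so a fixed product has fixed factors; then [cN1]
     kills [m] and [cVY] kills [v]. *)
  have cmv x : x \in Q -> v ^ x = v /\ m ^ x = m.
    move=> Qx; have : v^-1 * v ^ x = m * (m ^ x)^-1.
      apply: (mulgI v); apply: (mulIg (m ^ x)).
      rewrite mulKVg (mulgA v m) mulgKV -conjMg.
      by rewrite conjgE (centP cvm _ Qx) mulKg.
    move=> eq_vm; have : v^-1 * v ^ x \in V :&: M.
      rewrite inE groupMl ?groupV // memJ_norm ?(subsetP nVQ) // Vv /=.
      by rewrite eq_vm groupMl ?groupV // memJ_norm ?(subsetP nMQ).
    rewrite tiVM => /set1P eq1; split.
      by apply: (mulgI v^-1); rewrite eq1 mulVg.
    by apply: (mulIg (m ^ x)^-1); rewrite mulgV -eq_vm eq1.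
  have m1 : m = 1.
    case/morphimP: Mm cmv => k Nk _ -> cmv; suff -> : k = 1 by apply: morph1.
    apply/set1P; rewrite -[[set 1]]cN1 inE Nk /=.
    apply/centP=> _ /morphimP[_ _ /morphimP[x nx Px ->] ->].
    have [_] := cmv (f x) (mem_morphim _ Px Px).
    rewrite fE hE gJ ?DfP // pairJ => /gI[] //.
    by move=> kx _; apply/commgP/conjg_fixP.
  rewrite m1 mulg1 inE -in_set1 -[[set 1]]cVY inE Vv /=.
  apply/centP=> x Yx; apply/commgP/conjg_fixP.
  by have [] := cmv x (subsetP sYQ x Yx).
have [z Zz ntz] : exists2 z, z \in Z & z != 1.
  by apply/trivgPn; rewrite trivg_card1 oZ neq_ltn prime_gt1 ?orbT.
have Pz := subsetP sZP z Zz.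
have fz : f z = g (1, z) by rewrite fE f1Z.
have ntzp : (1, z) != 1 :> gT1 * gT0.
  by apply: contraNneq ntz => -[->].
have Vc w : w \in W -> [~ w, f z] \in V.
  by move=> Ww; rewrite mem_commg // mem_morphim.
(* The witness [b] in [V] is moved by [(m, 1)], since [(1, z)], [(m, 1)] and their product are all
   nontrivial. *)
have cMV : 'C_M(V) = 1.
  apply/trivgP/subsetP=> _ /setIP[/morphimP[m Nm _ ->] /centP cm].
  rewrite hE inE; have [-> | ntm] := eqVneq m 1; first by rewrite -hE morph1.
  have Ww : e (indicator _ q 1) \in W by rewrite mem_morphim ?inE.
  pose b := [~ e (indicator _ q 1), g (1, z)].
  have /eqP[] : b ^ g (m, 1) != b.
    apply: regular_wreath_commg_moved; rewrite ?DfP //.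
      by apply: contraNneq ntm => -[->].
    by apply: contraNneq ntz => -[_]; rewrite mulg1 => ->.
  apply/conjg_fixP/commgP; apply: commute_sym; apply: cm.
  by rewrite /b -fz Vc.
have hallV : q.-Hall(V <*> M) V.
  rewrite /pHall joing_subl qV /= -divgS ?joing_subl //.
  rewrite -(sdprod_card defN) mulKn //.
  exact: pgroupS sMK q'K.
have nVN : V <| V <*> M by rewrite /normal joing_subl join_subG normG nVM.
have FN : 'F(V <*> M) = V.
  apply: (@Fitting_eq_abelian_Hall _ q _ V) => //.
  apply/subsetP=> y /setIP[/memN[v [m [Vv Mm ->]]] cvm].
  suff : m \in 'C_M(V) by rewrite cMV => /set1P->; rewrite mulg1.
  by rewrite inE Mm -(groupMl m (subsetP abV v Vv)).
have isoM : M \isog (V <*> M) / V := sdprod_isog defN.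
have isoN1 : N1 \isog M by apply: sub_isog.
have ntV : V :!=: 1.
  apply/trivgPn; exists [~ e (indicator _ q 1), f z].
    by rewrite Vc // mem_morphim ?inE.
  apply/eqP=> /eqP/conjg_fixP/eqP; rewrite fz.
  by rewrite (regular_wreath_indicator _ _ _ 1) ?DfP // inE (negPf ntzp).
exists T, (V <*> M)%G, f; split; last split.
- split=> //.
  + by rewrite normsY.
  + rewrite /pgroup -(sdprod_card defN) pnatM (pi_pnat qV) //=.
    exact: morphim_pgroup.
  + have: solvable (V <*> M); last by [].
    by rewrite (series_sol nVN) abelian_sol //= -(isog_sol isoM) morphim_sol.
- apply: fitting_height_succ.
    by apply: contraNneq ntV => N_1; rewrite -subG1 -N_1 joing_subl.
  rewrite FN; apply: isog_fitting_height htN1.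
  exact: isog_trans isoN1 isoM.
rewrite ltnS => n_gt0 u Pu; apply/trivgPn.
have [Zu | notZu] := boolP (u \in Z).
  (* Term [0] of the Fitting series is [1], and [N1] has positive height. *)
  have /trivgPn[m Nm ntm] : N1 :!=: 1.
    by have [_ /(_ 0 n_gt0)] := htN1; rewrite eq_sym.
  exists (h m); last by rewrite morph_injm_eq1.
  have Mm : h m \in M by apply: mem_morphim.
  rewrite inE (subsetP (joing_subr _ _)) //=; apply/cent1P.
  have Yu : f u \in Y by apply: mem_morphim.
  exact: centsP cYM (h m) Mm (f u) Yu.
have u_order : prime #[u].
  have ntu : #[u] != 1%N.
    by rewrite order_eq1; apply: contraNneq notZu => ->.
  by have /(prime_nt_dvdP p_pr ntu)-> := dvdn_trans (dvdn_exponent Pu) expP.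
have tiuZ : <[u]> :&: Z = 1 by apply: prime_TIg; rewrite ?cycle_subG.
(* The generator is the preimage of [f u] under [g], so [f u] fixes [b]; as it commutes with [f z],
   it fixes [[~ b, f z]] too. *)
pose b := e (indicator _ q <[(f1 (coset Z u), u)]>).
have Wb : b \in W by rewrite mem_morphim ?inE.
exists [~ b, f z].
  rewrite inE (subsetP (joing_subl _ _)) ?Vc //=; apply/cent1P.
  apply/commgP/conjg_fixP; rewrite conjRg; congr [~ _, _].
    by apply/eqP; rewrite regular_wreath_indicator ?DfP ?cycle_id.
  apply/conjg_fixP/commgP/commute_sym.
  have Qu : f u \in Q by apply: mem_morphim.
  have Yz : f z \in Y by apply: mem_morphim.
  exact: centsP cYQ (f u) Qu (f z) Yz.
apply/eqP=> /eqP/conjg_fixP/eqP; rewrite fz regular_wreath_indicator ?DfP //.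
(* If [f z] fixed [b], then [(1, z)] would lie in that cyclic group, and its second coordinate [z]
   would be a power of [u], against [tiuZ]. *)
case/cycleP=> i /(congr1 snd) /= zi; case/eqP: ntz; apply/set1P.
rewrite -[[set 1]]tiuZ inE Zz andbT zi; apply/cycleP; exists i.
by elim: i {zi} => // i IHi; rewrite !expgS /= IHi.
Qed.

(** Divisibility of the exponent, unlike equality with [p], passes to quotients and covers the
    trivial group, where the induction starts with [N = 1]. *)
Lemma fpf_tower_exists (p n : nat) (gT0 : finGroupType) (P : {group gT0}) :
  prime p -> #|P| = (p ^ n)%N -> exponent P %| p -> fpf_tower p n P.
Proof.
move=> p_pr; elim: n gT0 P => [|n IHn] gT0 P oP expP.
  have P1 : P :=: 1 by apply/eqP; rewrite trivg_card1 oP.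
  exists gT0, 1%G, (idm_morphism P); split; last split=> //.
    split; rewrite ?injm_idm ?norms1 ?pgroup1 ?solvable1 //.
    by apply/trivgP/subsetIl.
have pP : p.-group P by rewrite /pgroup oP pnatX pnat_id.
have ntP : P :!=: 1.
  by rewrite trivg_card1 oP -(exp1n n.+1) eqn_exp2r // neq_ltn prime_gt1 ?orbT.
have ntZ : 'Z(P) != 1 by rewrite (center_nil_eq1 (pgroup_nil pP)).
have [_ pZ _] := pgroup_pdiv (pgroupS (center_sub P) pP) ntZ.
have [z Zz oz] := Cauchy p_pr pZ.
have sZZ : <[z]> \subset 'Z(P) by rewrite cycle_subG.
have nZP : <[z]> <| P by apply: sub_center_normal.
apply: (fpf_tower_step p n _ P <[z]>%G) => //; apply: IHn.
  rewrite card_quotient ?normal_norm // -divgS ?normal_sub // oP -orderE oz.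
  by rewrite expnS mulKn ?prime_gt0.
exact: dvdn_trans (exponent_quotient _ _) expP.
Qed.

Theorem theorem3p3 (p n : nat) (gT0 : finGroupType) (P : {group gT0}) :
  prime p -> 1 < n -> #|P| = (p ^ n)%N -> exponent P = p ->
  exists (gT : finGroupType) (G N Q : {group gT}),
    [/\ N ><| Q = G, Q \isog P, 'C_N(Q) = 1 & redundant_Sylow p G] /\
    [/\ p^'.-group N, solvable N & fitting_height_eq N n].
Proof.
move=> p_pr n_gt1 oP expP.
have [|gT [N [f [[injf nNP p'N solN cNP] [htN cNu]]]]] :=
  fpf_tower_exists p n gT0 P p_pr oP; first by rewrite expP.
have pQ : p.-group (f @* P).
  by rewrite morphim_pgroup // /pgroup oP pnatX pnat_id.
have coNQ : coprime #|N| #|f @* P|.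
  by rewrite coprime_sym; apply: pnat_coprime pQ p'N.
have defG : N ><| f @* P = N <*> f @* P.
  by rewrite sdprodEY // coprime_TIg.
exists gT, (N <*> f @* P)%G, N, (f @* P)%G; split; split=> //.
  by rewrite isog_sym sub_isog.
apply: redundant_Sylow_sdprod (defG) _ cNP _ => [|_ /morphimP[u Pu _ ->]].
  rewrite /pHall joing_subr pQ /= -divgS ?joing_subr //.
  by rewrite -(sdprod_card defG) mulnK.
exact: cNu.
Qed.
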